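(* Let $G$ be a connected graph with node set $\{0,1,\dots,n\}$ and let $F$ be a nonempty proper face of $\check\nabla_G$. (1) If $G_F$ contains a bridge, then $\mathcal{K}^\circ(\vec G_F)=\varnothing$. (2) If $G_F$ is bridgeless, then $$\mathcal{K}^\circ(\vec G_F)=\{K\mid \vec G_F\text{ (weighted by }K)\text{ is balanced with respect to a nonzero circulation on }\vec G_F\}.$$
   Context: Graph and system: $G$ is a finite simple connected undirected graph with nodes $\{0,1,\dots,n\}$; $i\sim j$ denotes adjacency. Given nonzero complex $k_{ij}=k_{ji}$ for each edge, put $a_{ij}=k_{ij}/(2\mathfrak{i})$ and $x_0=1$. The algebraic Kuramoto system is $f_{G,i}=\overline w_i-\sum_{j\sim i}a_{ij}(x_i/x_j-x_j/x_i)$, $i=1,\dots,n$. The randomized system is $\vec f_G^{\,*}=R\,\vec f_G$ for a generic nonsingular complex $n\times n$ matrix $R$ (so that no monomial $x_i/x_j$, $i\sim j$, is cancelled in any component). Faces: $\check\nabla_G=\{\pm(\vec e_i-\vec e_j)\mid i\sim j\}\cup\{\vec 0\}\subset\mathbb{R}^n$, $\vec e_0=\vec 0$; a (proper) face $F$ of $\check\nabla_G$ is a subset of $\check\nabla_G$ such that $\operatorname{conv}(F)$ is a (proper) face of $\operatorname{conv}(\check\nabla_G)$ and $F=\check\nabla_G\cap\operatorname{conv}(F)$. Since $\vec 0$ is interior, a proper face consists of points $\vec e_i-\vec e_j$. The facial subdigraph $\vec G_F$ has arcs $\{(i,j)\mid \vec e_i-\vec e_j\in F\}$ and nodes the endpoints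 of these; $G_F$ is its underlying undirected graph. $\operatorname{init}_F(\vec f_G^{\,*})$ is the system obtained by keeping in each component of $\vec f_G^{\,*}$ only the terms whose exponent vectors lie in $F$. Exceptional coefficients: $\mathcal{K}^\circ(\vec G_F)$ is the set of $K=(k_{ij})_{(i,j)\in\mathcal{E}(\vec G_F)}\in(\mathbb{C}^* )^{|F|}$ for which $\operatorname{init}_F(\vec f_G^{\,*})=\vec 0$ has a solution in $(\mathbb{C}^* )^n$. Bridges: a bridge is an edge contained in no cycle; a graph without bridges is bridgeless. Balancing: an acyclic digraph whose underlying graph is a cycle is balanced if it has equally many arcs pointing clockwise and counterclockwise. A circulation on a digraph $\vec H$ is an assignment of complex weights $\eta=\{\eta_{ij}\mid(i,j)\in\mathcal{E}(\vec H)\}$ such that at every node the sum of incoming weights equals the sum of outgoing weights; ''nonzero circulation'' here means all $\eta_{ij}\ne 0$. For an acyclic digraph $\vec H$ with underlying graph $H$, let $C_1,\dots,C_d$ be the cycles of $H$ and $\vec C_1,\dots,\vec C_d$ the corresponding subdigraphs of $\vec H$. $(\vec H,K)$ is balanced with respect to a circulation $\eta$ with all $\eta_{ij}\neq0$ if each $\vec C_\ell$ is balanced and, for each $\ell=1,\dots,d$, $$\prod_{(i,j)\in\mathcal{E}^+(\vec C_\ell)}\frac{k_{ij}}{\eta_{ij}}=\prod_{(i,j)\in\mathcal{E}^-(\vec C_\ell)}\frac{k_{ij}}{\eta_{ij}},$$ where $\mathcal{E}^+(\vec C_\ell)$, $\mathcal{E}^-(\vec C_\ell)$ are the sets of arcs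 of $\vec C_\ell$ in the counterclockwise and clockwise orientations (for a fixed traversal of $C_\ell$). *)

(* Defs.v *)
From mathcomp Require Export all_boot all_order all_algebra.
From mathcomp Require Export finmap.
From mathcomp Require Export boolp classical_sets reals.
From mathcomp Require Export complex.
From mathcomp.multinomials Require Export monalg.

#[export] Set Implicit Arguments.
#[export] Unset Strict Implicit.
#[export] Unset Printing Implicit Defensive.

Import Order.TTheory GRing.Theory Num.Theory.

Local Open Scope classical_set_scope.
Local Open Scope ring_scope.

(** * Convex hulls and faces of polytopes *)

Definition conv_hull (R : realType) (n : nat) (S : set 'rV[R]_n) :
    set 'rV[R]_n :=
  [set x | exists (m : nat) (t : 'I_m -> R) (p : 'I_m -> 'rV[R]_n),
     [/\ forall i, 0 <= t i, \sum_i t i = 1, forall i, S (p i)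
       & x = \sum_i t i *: p i]].

(* A face is cut out by a linear inequality valid on [P]; thus [set0] and [P]
   itself are faces. *)
Definition is_face (R : realType) (n : nat) (Q P : set 'rV[R]_n) : Prop :=
  exists (alpha : 'rV[R]_n) (c : R),
    (forall x, P x -> \sum_i alpha 0 i * x 0 i <= c) /\
    Q = [set x | P x /\ \sum_i alpha 0 i * x 0 i = c].

Definition is_proper_face (R : realType) (n : nat) (Q P : set 'rV[R]_n) :
    Prop :=
  is_face Q P /\ Q <> P.

(** * The point configuration of a graph and its faces *)

(* [evec i] is the i-th standard basis vector for i = 1, ..., n, where
   coordinate [l : 'I_n] corresponds to node [l + 1], and [evec 0 = 0]. *)
Definition evec (T : pzSemiRingType) (n : nat) (i : 'I_n.+1) : 'rV[T]_n :=
  \row_l (i == lift ord0 l)%:R.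

(* The set is closed under negation since adjacency is symmetric. *)
Definition nabla (R : realType) (n : nat) (G : rel 'I_n.+1) : set 'rV[R]_n :=
  [set v | v = 0 \/ exists i j : 'I_n.+1, G i j /\
     (v = evec R i - evec R j \/ v = - (evec R i - evec R j))].

Arguments nabla R {n} G.

Definition proper_face_nabla (R : realType) (n : nat) (G : rel 'I_n.+1)
    (F : set 'rV[R]_n) : Prop :=
  [/\ F `<=` nabla R G,
      is_proper_face (conv_hull F) (conv_hull (nabla R G))
    & F = nabla R G `&` conv_hull F].

(** * Digraphs

    A digraph is given by its set of arcs; its nodes are their endpoints. *)

Definition arc (V : finType) (A : {set V * V}) : finType :=
  {a : V * V | a \in A}.

Definition src (V : finType) (A : {set V * V}) (a : arc A) : V := (val a).1.
Definition tgt (V : finType) (A : {set V * V}) (a : arc A) : V := (val a).2.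

Definition is_node (V : finType) (A : {set V * V}) (v : V) : Prop :=
  exists a : arc A, src a = v \/ tgt a = v.

Definition underlying (V : finType) (A : {set V * V}) : rel V :=
  fun i j => ((i, j) \in A) || ((j, i) \in A).

Definition acyclic (V : finType) (A : {set V * V}) : Prop :=
  forall p : seq V, p <> [::] -> ~~ cycle (fun i j => (i, j) \in A) p.

(* The sequence [p] also fixes a starting point and a traversal direction. *)
Definition graph_cycle (V : finType) (H : rel V) (p : seq V) : bool :=
  ucycleb H p && (2 < size p)%N.

Definition steps (V : finType) (p : seq V) (i j : V) : bool :=
  (i \in p) && (j == next p i).

Definition bridge (V : finType) (H : rel V) (i j : V) : Prop :=
  H i j /\
  forall p, graph_cycle H p -> ~~ (steps p i j || steps p j i).

Definition has_bridge (V : finType) (H : rel V) : Prop :=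
  exists i j, bridge H i j.

Definition bridgeless (V : finType) (H : rel V) : Prop := ~ has_bridge H.

(** * Circulations and balanced weighted digraphs *)

Definition circulation (C : nmodType) (V : finType) (A : {set V * V})
    (eta : {ffun arc A -> C}) : Prop :=
  forall v, is_node A v ->
    \sum_(a : arc A | tgt a == v) eta a = \sum_(a : arc A | src a == v) eta a.

Definition nonzero_circulation (C : nmodType) (V : finType) (A : {set V * V})
    (eta : {ffun arc A -> C}) : Prop :=
  circulation eta /\ forall a, eta a != 0.

(* The arcs lying on the cycle [p], in the direction of its traversal, resp.
   in the opposite direction. *)
Definition arcs_fwd (V : finType) (A : {set V * V}) (p : seq V) :
    {set arc A} :=
  [set a : arc A | steps p (src a) (tgt a)]%SET.

Definition arcs_bwd (V : finType) (A : {set V * V}) (p : seq V) :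
    {set arc A} :=
  [set a : arc A | steps p (tgt a) (src a)]%SET.

Definition balanced_cycle (V : finType) (A : {set V * V}) (p : seq V) : Prop :=
  #|arcs_fwd A p| = #|arcs_bwd A p|.

Definition balanced (C : fieldType) (V : finType) (A : {set V * V})
    (K eta : {ffun arc A -> C}) : Prop :=
  [/\ acyclic A, nonzero_circulation eta
    & forall p, graph_cycle (underlying A) p ->
        balanced_cycle A p /\
        \prod_(a in arcs_fwd A p) (K a / eta a) =
        \prod_(a in arcs_bwd A p) (K a / eta a)].

(** * Laurent polynomials

    A Laurent polynomial in x_1, ..., x_n is a finitely supported family of
    coefficients indexed by exponent vectors in Z^n. *)

Notation laurent C n := {malg C['rV[int]_n]}.

Definition leval (C : fieldType) (n : nat) (f : laurent C n) (x : 'I_n -> C) :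
    C :=
  \sum_(m <- msupp f) f@_m * \prod_l x l ^ m 0 l.

Definition linit (R : realType) (C : fieldType) (n : nat) (F : set 'rV[R]_n)
    (f : laurent C n) : laurent C n :=
  \sum_(m <- msupp f | map_mx intr m \in F) << f@_m *g m >>.

(** * The algebraic Kuramoto system *)

Definition edge_weights (C : fieldType) (V : finType) (G : rel V)
    (k : V -> V -> C) : Prop :=
  forall i j, G i j -> k i j != 0 /\ k i j = k j i.

(* [l : 'I_n] stands for node [l + 1]. The monomial x_i / x_j has exponent
   [evec i - evec j], which accounts for x_0 = 1. *)
Definition kuramoto (R : realType) (n : nat) (G : rel 'I_n.+1)
    (w : 'I_n -> R[i]) (k : 'I_n.+1 -> 'I_n.+1 -> R[i]) (l : 'I_n) :
    laurent R[i] n :=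
  let i := lift ord0 l in
  let a j := k i j / (2 * 'i) in
  << w l *g 0 >> -
  \sum_(j | G j i)
     (<< a j *g evec int i - evec int j >> -
      << a j *g evec int j - evec int i >>).

Definition randomized (R : realType) (n : nat) (Q : 'M[R[i]]_n)
    (f : 'I_n -> laurent R[i] n) (m : 'I_n) : laurent R[i] n :=
  \sum_l Q m l *: f l.

(* The genericity required of the randomizing matrix. Since the coefficient of
   x_i / x_j in the m-th component is k_ij / 2i times the difference of the
   entries (m, j) and (m, i) of [Q] (read as 0 at column 0), it does not
   actually depend on [k] or [w]. *)
Definition generic_matrix (R : realType) (n : nat) (G : rel 'I_n.+1)
    (w : 'I_n -> R[i]) (Q : 'M[R[i]]_n) : Prop :=
  Q \in unitmx /\
  forall k, edge_weights G k ->
  forall (m : 'I_n) (i j : 'I_n.+1), G i j ->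
    evec int i - evec int j \in msupp (randomized Q (kuramoto G w k) m).

(** * Facial subdigraphs and exceptional coefficients *)

Definition facial_arcs (R : realType) (n : nat) (F : set 'rV[R]_n) :
    {set 'I_n.+1 * 'I_n.+1} :=
  [set a : 'I_n.+1 * 'I_n.+1 | evec R a.1 - evec R a.2 \in F]%SET.

Definition facial_graph (R : realType) (n : nat) (F : set 'rV[R]_n) :
    rel 'I_n.+1 :=
  underlying (facial_arcs F).

Definition arc_coefs (R : realType) (n : nat) (F : set 'rV[R]_n) : Type :=
  {ffun arc (facial_arcs F) -> R[i]}.

Definition in_torus (R : realType) (n : nat) (F : set 'rV[R]_n)
    (K : arc_coefs F) : Prop :=
  forall a, K a != 0.

(* [K] only prescribes the weights of the edges of the facial graph; the
   weights of the other edges do not occur in the initial system, so the choice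
   of the extension [k] is immaterial. *)
Definition exceptional (R : realType) (n : nat) (G : rel 'I_n.+1)
    (w : 'I_n -> R[i]) (Q : 'M[R[i]]_n) (F : set 'rV[R]_n) :
    set (arc_coefs F) :=
  [set K | in_torus K /\
     exists k, [/\ edge_weights G k,
       forall a : arc (facial_arcs F), k (src a) (tgt a) = K a
     & exists x : 'I_n -> R[i], (forall l, x l != 0) /\
         forall m, leval (linit F (randomized Q (kuramoto G w k) m)) x = 0]].

Arguments exceptional {R n} G w Q F.

(* Main.v *)
Require Import Defs.
Import Order.TTheory GRing.Theory Num.Theory.

Local Open Scope classical_set_scope.
Local Open Scope ring_scope.

(** The statement reduces to a question about flows on the facial digraph.

    A supporting functional of a proper face [F] gives a height [h] on the nodes
    and a constant [c > 0] such that [h i - h j = c] along every facial arc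
    ([face_grading]): were [c] zero, the symmetry of the configuration would
    force the face to be everything. Hence the facial digraph has no opposite
    arcs, is acyclic, and each of its cycles is balanced, and [0] is not in [F],
    so that taking initial forms removes the constant terms.

    Since the randomizing matrix is invertible, it may be dropped from the
    initial system. What is left at node [i] says that the numbers
    [k_ij x_i / x_j], up to the common factor [1 / 2i], have equal inflow and
    outflow at [i]; at node 0 this follows from the other nodes, and [x_0 = 1] is
    a mere normalization, the numbers being invariant under scaling of [x]. So
    [K] is exceptional iff [K_ij X_i / X_j] is a circulation for some nowhere
    zero function [X] on the nodes ([exceptional_iff]).

    Such a circulation is nowhere zero, but every circulation vanishes on a
    bridge, being the only arc across a cut ([bridge_no_flow]); this is the first
    part. For the second part, a nowhere zero circulation [eta] has the form
    [K_ij X_i / X_j] iff [eta / K] is the multiplicative gradient of a potential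
    [X]. By telescoping, its products along cycles are then trivial, which is the
    balancing condition; conversely trivial products along simple cycles suffice
    for the existence of a potential ([potential_ex], [balanced_iff]). *)

(** * Sums over arcs and products along cycles *)

Section ArcSums.
Context (V : finType) (A : {set V * V}).
Context (T : Type) (idx : T) (op : Monoid.com_law idx) (f : V -> V -> T).

Lemma big_arcs (P : V -> V -> bool) :
  \big[op/idx]_(a : arc A | P (src a) (tgt a)) f (src a) (tgt a) =
  \big[op/idx]_i \big[op/idx]_(j | ((i, j) \in A) && P i j) f i j.
Proof.
rewrite -(big_sub_cond (mem A) (fun u => P u.1 u.2) (fun u => f u.1 u.2)).
by rewrite pair_big_dep; apply: eq_bigl => -[].
Qed.

Lemma big_arcs_src (v : V) :
  \big[op/idx]_(a : arc A | src a == v) f (src a) (tgt a) =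
  \big[op/idx]_(j | (v, j) \in A) f v j.
Proof.
rewrite (big_arcs (fun i _ => i == v)) (bigD1 v) //= [X in op _ X]big1.
  by rewrite Monoid.mulm1; apply: eq_bigl => j; rewrite eqxx andbT.
by move=> i /negPf nvi; rewrite big_pred0 // => j; rewrite nvi andbF.
Qed.

Lemma big_arcs_tgt (v : V) :
  \big[op/idx]_(a : arc A | tgt a == v) f (src a) (tgt a) =
  \big[op/idx]_(i | (i, v) \in A) f i v.
Proof.
rewrite (big_arcs (fun _ j => j == v)) [RHS]big_mkcond.
by apply: eq_bigr => i _; rewrite big_mkcondl big_pred1_eq.
Qed.

Lemma big_arcs_fwd (p : seq V) : uniq p ->
  \big[op/idx]_(a in arcs_fwd A p) f (src a) (tgt a) =
  \big[op/idx]_(v <- p | (v, next p v) \in A) f v (next p v).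
Proof.
move=> Up; rewrite (eq_bigl (fun a : arc A => steps p (src a) (tgt a)));
  last by move=> a; rewrite inE.
rewrite (big_arcs (steps p)) [RHS]big_mkcond [RHS]big_uniq // [RHS]big_mkcond.
apply: eq_bigr => i _; rewrite /steps; case: (i \in p) => /=.
  by rewrite big_mkcondl big_pred1_eq.
by rewrite big_pred0 // => j; rewrite andbF.
Qed.

Lemma big_arcs_bwd (p : seq V) : uniq p ->
  \big[op/idx]_(a in arcs_bwd A p) f (src a) (tgt a) =
  \big[op/idx]_(v <- p | (next p v, v) \in A) f (next p v) v.
Proof.
move=> Up.
rewrite (eq_bigl (fun a : arc A => steps p (tgt a) (src a)));
  last by move=> a; rewrite inE.
rewrite (big_arcs (fun i j => steps p j i)) (exchange_big_dep xpredT) //=.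
rewrite [RHS]big_mkcond [RHS]big_uniq // [RHS]big_mkcond.
apply: eq_bigr => i _; rewrite /steps; case: (i \in p) => /=.
  by rewrite big_mkcondl big_pred1_eq.
by rewrite big_pred0 // => j; rewrite andbF.
Qed.

End ArcSums.

(** A traversal of a cycle splits into the arcs followed in their own direction
    and those followed backwards. *)
Lemma big_cycle_arcs (V : finType) (A : {set V * V}) (T : Type) (idx : T)
    (op : Monoid.com_law idx) (f : V -> V -> T) (p : seq V)
    (A_anti : forall i j, (i, j) \in A -> (j, i) \notin A) :
  graph_cycle (underlying A) p ->
  \big[op/idx]_(v <- p) f v (next p v) =
  op (\big[op/idx]_(a in arcs_fwd A p) f (src a) (tgt a))
     (\big[op/idx]_(a in arcs_bwd A p) f (tgt a) (src a)).
Proof.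
case/andP=> /andP[cyc_p Up] _.
rewrite big_arcs_fwd // (@big_arcs_bwd _ _ _ _ _ (fun i j => f j i)) //.
rewrite (bigID (fun v => (v, next p v) \in A)) /=; congr (op _ _).
rewrite big_seq_cond [RHS]big_seq_cond; apply: eq_bigl => v.
have [vp /=|//] := boolP (v \in p).
have := next_cycle cyc_p vp; rewrite /underlying.
by have [/A_anti/negPf->|_ /= ->] := boolP ((v, next p v) \in A).
Qed.

Lemma underlying_sym (V : finType) (A : {set V * V}) :
  symmetric (underlying A).
Proof. by move=> i j; rewrite /underlying orbC. Qed.

Lemma underlying_irr (V : finType) (A : {set V * V}) :
  (forall i j, (i, j) \in A -> (j, i) \notin A) -> irreflexive (underlying A).
Proof.
by move=> anti i; rewrite /underlying orbb; apply/negP => /[dup] /anti/negP.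
Qed.

Lemma arc_in (V : finType) (A : {set V * V}) (a : arc A) : (src a, tgt a) \in A.
Proof. by rewrite -surjective_pairing (valP a). Qed.

Lemma perm_map_next (V : eqType) (p : seq V) :
  uniq p -> perm_eq (map (next p) p) p.
Proof.
move=> Up; apply: uniq_perm => //.
  by rewrite map_inj_uniq //; apply: can_inj (prev_next Up).
move=> v; apply/mapP/idP => [[u pu ->]|pv]; first by rewrite mem_next.
by exists (prev p v); rewrite ?mem_prev // next_prev.
Qed.

Lemma sum_next (V : eqType) (Z : zmodType) (h : V -> Z) (p : seq V) :
  uniq p -> \sum_(v <- p) (h v - h (next p v)) = 0.
Proof.
move=> Up; rewrite sumrB -[X in _ - X](big_map (next p) xpredT h).
by rewrite (perm_big _ (perm_map_next Up)) subrr.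
Qed.

Lemma prod_next (V : eqType) (C : fieldType) (X : V -> C) (p : seq V) :
  (forall v, X v != 0) -> uniq p -> \prod_(v <- p) (X v / X (next p v)) = 1.
Proof.
move=> X0 Up; rewrite prodf_div -[X in _ / X](big_map (next p) xpredT X).
rewrite (perm_big _ (perm_map_next Up)) divff //.
by rewrite prodf_seq_neq0; apply/allP => v _ /=.
Qed.

(** * Bridges *)

(** A simple path from [j] to [i] closes up, by the step from [i] to [j], to a
    cycle; it has more than two nodes since [i] does not follow [j] directly. *)
Lemma connect_close_cycle (V : finType) (e : rel V) (i j : V) :
  i != j -> ~~ e j i -> connect e j i ->
  exists c : seq V,
    [/\ uniq c, (2 < size c)%N, i \in c, next c i = j
      & cycle (fun u v => e u v || ((u == i) && (v == j))) c].
Proof.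
move=> nij nji /connectP[p0 ep0 ip0].
move: ep0 ip0 => /shortenP[p ep Up _] Di {p0}.
case/lastP: p => [|q k] in ep Up Di *; first by rewrite Di /= eqxx in nij.
rewrite last_rcons in Di; rewrite -{k}Di in ep Up.
exists (i :: j :: q); split.
- by move: Up; rewrite -rcons_cons rcons_uniq /=.
- by case: q ep {Up} => //=; rewrite andbT (negPf nji).
- exact: mem_head.
- by rewrite /= eqxx.
- rewrite /= !eqxx orbT /=; apply: sub_path ep.
  by move=> u v ->.
Qed.

(** The graph [H] with the edge between [i] and [j] removed. *)
Definition bridge_complement (V : finType) (H : rel V) (i j : V) : rel V :=
  fun u v => H u v && ~~ (((u == i) && (v == j)) || ((u == j) && (v == i))).

Lemma bridge_disconnects (V : finType) (H : rel V) (i j : V) :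
  irreflexive H -> bridge H i j -> ~~ connect (bridge_complement H i j) j i.
Proof.
move=> H_irr [Hij noc]; have nij: i != j.
  by apply: contraTneq Hij => ->; rewrite H_irr.
apply/negP => /connect_close_cycle[//||c [Uc c2 ic ni cyc_c]].
  by rewrite /bridge_complement !eqxx orbT andbF.
have /noc : graph_cycle H c.
  rewrite /graph_cycle c2 /ucycleb Uc !andbT; apply: sub_cycle cyc_c => u v.
  by case/orP => [/andP[]//|/andP[/eqP-> /eqP->]].
by rewrite /steps ic ni eqxx.
Qed.

Lemma bridge_sym (V : finType) (H : rel V) (i j : V) :
  symmetric H -> bridge H i j -> bridge H j i.
Proof.
move=> H_sym [Hij noc]; split; first by rewrite H_sym.
by move=> p /noc; rewrite orbC.
Qed.

(** * Multiplicative potentials *)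

(** Edges are added one by one. An edge joining two components of the graph built
    so far is accommodated by rescaling the potential on one of them; an edge
    inside a component closes a simple cycle, all of whose other factors are
    known, and the cycle condition determines the remaining one. *)
Lemma potential_ex (V : finType) (C : fieldType) (H : rel V)
    (psi : V -> V -> C) :
  irreflexive H -> symmetric H ->
  (forall i j, H i j -> psi i j != 0 /\ psi j i = (psi i j)^-1) ->
  (forall p, graph_cycle H p -> \prod_(v <- p) psi v (next p v) = 1) ->
  exists X : V -> C, (forall v, X v != 0) /\
    forall i j, H i j -> psi i j = X i / X j.
Proof.
move=> H_irr H_sym psiV psi_cyc.
suff /(_ (enum [pred u | H u.1 u.2]))[|X [X0 XE]]: forall s : seq (V * V),
    {in s, forall u, H u.1 u.2} ->
    exists X : V -> C, (forall v, X v != 0) /\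
      {in s, forall u, psi u.1 u.2 = X u.1 / X u.2}.
- by move=> u; rewrite mem_enum.
- exists X; split=> // i j Hij; apply: (XE (i, j)).
  by rewrite mem_enum.
elim=> [_|[i j] s IHs Hs]; first by exists (fun=> 1); split=> // v;
  apply: oner_neq0.
have [|X [X0 XE]] := IHs; first by move=> u us; apply: Hs; rewrite inE us orbT.
have Hij : H i j by apply: (Hs (i, j)); rewrite inE eqxx.
have nij: i != j by apply: contraTneq Hij => ->; rewrite H_irr.
pose e u v := ((u, v) \in s) || ((v, u) \in s).
have eH u v : e u v -> H u v.
  move=> euv; case/orP: euv => uvs; last rewrite H_sym.
    by apply: (Hs (u, v)); rewrite inE uvs orbT.
  by apply: (Hs (v, u)); rewrite inE uvs orbT.
have eX u v : e u v -> psi u v = X u / X v.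
  move=> euv; have [_ psiE] := psiV _ _ (eH _ _ euv).
  case/orP: euv => uvs; first exact: (XE (u, v)).
  by rewrite -[LHS]invrK -psiE (XE (v, u)) //= invf_div.
have e_sym : symmetric e by move=> u v; rewrite /e orbC.
have [eji|nji] := boolP (e j i).
  exists X; split=> // u; rewrite inE => /predU1P[->|us]; last exact: XE.
  by apply: eX; rewrite e_sym.
have [cji|ncji] := boolP (connect e j i).
  have [c [Uc c2 ic ni cyc_c]] := connect_close_cycle nij nji cji.
  exists X; split=> // u; rewrite inE => /predU1P[->/=|us]; last exact: XE.
  have psi1 : \prod_(v <- c) psi v (next c v) = 1.
    apply: psi_cyc; rewrite /graph_cycle c2 /ucycleb Uc !andbT.
    apply: sub_cycle cyc_c => v w.
    by case/orP => [/eH//|/andP[/eqP-> /eqP->]].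
  (* Compare the products of [psi] and of the gradient of [X] along [c]. *)
  have := etrans (prod_next X0 Uc) (esym psi1); rewrite !(bigD1_seq i) //= ni.
  set q := (X in psi i j * X).
  have q0 : q != 0.
    have : \prod_(v <- c) psi v (next c v) != 0 by rewrite psi1 oner_neq0.
    by rewrite (bigD1_seq i) //= mulf_eq0 negb_or => /andP[].
  suff -> : \prod_(v <- c | v != i) (X v / X (next c v)) = q.
    by move/(mulIf q0)=> ->.
  rewrite /q big_seq_cond [RHS]big_seq_cond; apply: eq_bigr => v /andP[vc nvi].
  apply/esym/eX; have := next_cycle cyc_c vc.
  by rewrite (negPf nvi) orbF.
(* Rescale on the component of [i] so as to satisfy the new edge. *)
exists (fun v => if connect e i v then X v * (psi i j * X j / X i) else X v).
have [psi0 _] := psiV _ _ Hij.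
split=> [v|u].
  by case: ifP => // _; rewrite !mulf_neq0 ?invr_neq0.
rewrite inE => /predU1P[->/=|us].
  rewrite connect0 ifN; last by rewrite (sym_connect_sym e_sym).
  by rewrite [X i * _]mulrC divfK ?mulfK.
rewrite (XE _ us).
have /(same_connect1r (sym_connect_sym e_sym)) -> // : e u.1 u.2.
  by rewrite /e -surjective_pairing us.
case: ifP => // _; rewrite -mulf_div divff ?mulr1 //.
by rewrite !mulf_neq0 ?invr_neq0.
Qed.

(** * Circulations *)

Section Flow.
Context (C : zmodType) (V : finType) (A : {set V * V}).
Implicit Type eta : {ffun arc A -> C}.

(** At a vertex that is no node of the digraph both sums are empty. *)
Lemma circulationP eta : circulation eta <->
  forall v, \sum_(a : arc A | tgt a == v) eta a =
            \sum_(a : arc A | src a == v) eta a.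
Proof.
split=> [circ v|circ v _]; last exact: circ.
have [/circ//|nv] := pselect (is_node A v).
by rewrite !big_pred0 // => a; apply/negP => /eqP av; apply: nv; exists a; auto.
Qed.

Lemma sum_net_flow eta (S : {set V}) :
  \sum_(v in S) (\sum_(a : arc A | tgt a == v) eta a -
                 \sum_(a : arc A | src a == v) eta a) =
  \sum_(a : arc A | tgt a \in S) eta a - \sum_(a : arc A | src a \in S) eta a.
Proof.
rewrite sumrB; congr (_ - _).
  rewrite [RHS](partition_big (@tgt V A) (mem S)) //; apply: eq_bigr => v vS.
  by apply: eq_bigl => a; case: eqP => [->|]; rewrite ?andbF //= vS.
rewrite [RHS](partition_big (@src V A) (mem S)) //; apply: eq_bigr => v vS.
by apply: eq_bigl => a; case: eqP => [->|]; rewrite ?andbF //= vS.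
Qed.

Lemma circulation_cut eta (S : {set V}) : circulation eta ->
  \sum_(a : arc A | tgt a \in S) eta a = \sum_(a : arc A | src a \in S) eta a.
Proof.
move=> /circulationP circ; apply/eqP; rewrite -subr_eq0 -sum_net_flow.
by rewrite big1 // => v _; rewrite circ subrr.
Qed.

(** Conservation at all vertices but one implies conservation at the last one,
    as the net flows add up to zero. *)
Lemma circulation_but_one eta (r : V) :
  (forall v, v != r -> \sum_(a : arc A | tgt a == v) eta a =
                       \sum_(a : arc A | src a == v) eta a) ->
  circulation eta.
Proof.
move=> circ; apply/circulationP => v.
have [->|/circ//] := eqVneq v r; apply/eqP; rewrite -subr_eq0.
have : \sum_(v in [set: V]%SET) (\sum_(a : arc A | tgt a == v) eta a -
                                 \sum_(a : arc A | src a == v) eta a) = 0.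
  rewrite sum_net_flow (eq_bigl (fun a : arc A => src a \in [set: V]%SET)).
    by rewrite subrr.
  by move=> a; rewrite !inE.
rewrite (bigD1 r) ?inE //= [X in _ + X]big1 ?addr0 => [->//|u /andP[_ /circ->]].
by rewrite subrr.
Qed.

(** An arc which is a bridge is the only arc between the component of its target
    in the rest of the graph and the complement of that component. *)
Lemma bridge_no_flow eta :
  (forall i j, (i, j) \in A -> (j, i) \notin A) ->
  has_bridge (underlying A) -> ~ nonzero_circulation eta.
Proof.
move=> A_anti [i0 [j0 br0]] [circ eta0].
have u_sym := @underlying_sym _ A.
have u_irr := underlying_irr A_anti.
have [i [j [Aij br]]] : exists i j, (i, j) \in A /\ bridge (underlying A) i j.
  have [+ _] := br0; rewrite /underlying => /orP[?|?]; first by exists i0, j0.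
  by exists j0, i0; split=> //; apply: bridge_sym.
have := bridge_disconnects u_irr br.
set e := bridge_complement _ _ _ => ncji.
pose a0 : arc A := Sub (i, j) Aij.
have e_sym : symmetric e.
  move=> u v; rewrite /e /bridge_complement u_sym; congr (_ && ~~ _).
  by rewrite orbC; congr (_ || _); rewrite andbC.
pose S := [set v | connect e j v]%SET.
have := circulation_cut S circ; rewrite (bigD1 a0) /=; last first.
  by rewrite inE /tgt /= connect0.
rewrite (eq_bigl (fun a : arc A => src a \in S)).
  by move/eqP; rewrite -[X in _ == X]add0r (inj_eq (addIr _)) (negPf (eta0 a0)).
move=> a; have [->|na] := eqVneq a a0.
  by rewrite andbF inE /src /= (negPf ncji).
rewrite andbT !inE; apply/esym/same_connect1r; first exact: sym_connect_sym.
rewrite /e /bridge_complement /underlying /src /tgt -surjective_pairing.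
rewrite (valP a) /=.
rewrite negb_or; apply/andP; split.
  by apply: contraNN na => /andP[/eqP ai /eqP aj]; apply/eqP/val_inj;
    rewrite [LHS]surjective_pairing ai aj.
apply: contraNN (A_anti _ _ Aij) => /andP[/eqP <- /eqP <-].
by rewrite -surjective_pairing (valP a).
Qed.

End Flow.

(** * Graded digraphs *)

(** A digraph with a height function on the vertices that drops by the same
    positive amount [c] along every arc. *)
Section Graded.
Context (R : realType) (V : finType) (A : {set V * V}) (h : V -> R) (c : R)
  (c_gt0 : 0 < c) (hA : forall i j, (i, j) \in A -> h i - h j = c).

Lemma graded_lt i j : (i, j) \in A -> h j < h i.
Proof. by move=> /hA hij; rewrite -subr_gt0 hij. Qed.

Lemma graded_anti i j : (i, j) \in A -> (j, i) \notin A.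
Proof.
by move=> /graded_lt ji; apply/negP => /graded_lt/(lt_trans ji); rewrite ltxx.
Qed.

Lemma graded_acyclic : acyclic A.
Proof.
case=> [//|x p] _; apply/negP => /= xp.
have : path (fun u v => h v < h u) x (rcons p x).
  by apply: sub_path xp => u v; apply: graded_lt.
move/(order_path_min (fun u v w vu wv => lt_trans wv vu))/allP/(_ x).
by rewrite mem_rcons mem_head ltxx => /(_ isT).
Qed.

(** The total change of height around a cycle is zero. *)
Lemma graded_balanced_cycle p :
  graph_cycle (underlying A) p -> balanced_cycle A p.
Proof.
move=> gp; have /andP[/andP[_ Up] _] := gp.
have := sum_next h Up.
rewrite (big_cycle_arcs _ (fun i j => h i - h j) graded_anti gp) /=.
have hsrc (a : arc A) : h (src a) - h (tgt a) = c.
  exact/hA/arc_in.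
rewrite (eq_bigr (fun=> c)) // [X in _ + X](eq_bigr (fun=> - c)); last first.
  by move=> a _; rewrite -opprB hsrc.
rewrite !sumr_const mulNrn => /eqP; rewrite subr_eq0 => /eqP.
rewrite -!(mulr_natr c) => /(mulfI (lt0r_neq0 c_gt0))/eqP.
by rewrite eqr_nat => /eqP.
Qed.

(** The circulation required by balancing is exactly one of the form
    [K_ij X_i / X_j] with [X] nowhere zero; the grading takes care of acyclicity
    and of the arc counts. *)
Lemma balanced_iff (C : fieldType) (K : {ffun arc A -> C}) :
  (forall a, K a != 0) ->
  (exists eta, balanced K eta) <->
  exists X : V -> C, (forall v, X v != 0) /\
    circulation [ffun a : arc A => K a * (X (src a) / X (tgt a))].
Proof.
move=> K0; split=> [[eta [_ [circ eta0] bal]]|[X [X0 circ]]].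
  have u_sym := @underlying_sym _ A.
  have u_irr := underlying_irr graded_anti.
  (* The ratio [eta / K] on arcs, and its antisymmetric extension [psi]. *)
  pose g i j : C := if insub (i, j) is Some a then eta a / K a else 0.
  have gE a : g (src a) (tgt a) = eta a / K a.
    by rewrite /g -surjective_pairing valK.
  have g0 i j : (i, j) \in A -> g i j != 0.
    by move=> Aij; rewrite (gE (Sub (i, j) Aij)) mulf_neq0 ?invr_neq0.
  pose psi i j := if (i, j) \in A then g i j else (g j i)^-1.
  have psiV i j : underlying A i j -> psi i j != 0 /\ psi j i = (psi i j)^-1.
    rewrite /underlying /psi; case: ifP => [Aij _|_ /= Aji].
      by rewrite (negPf (graded_anti Aij)) g0.
    by rewrite Aji invr_neq0 ?g0 ?invrK.
  have [|X [X0 XE]] := potential_ex u_irr u_sym psiV.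
    move=> p gp; rewrite (big_cycle_arcs _ psi graded_anti gp) /=.
    have [_ balp] := bal p gp.
    rewrite (eq_bigr (fun a => (K a / eta a)^-1)); last first.
      by move=> a _; rewrite /psi arc_in gE invf_div.
    rewrite [X in _ * X](eq_bigr (fun a => K a / eta a)); last first.
      by move=> a _; rewrite /psi (negPf (graded_anti (arc_in a))) gE invf_div.
    rewrite prodfV balp mulVf // prodf_seq_neq0; apply/allP => a _.
    by apply/implyP => _; rewrite mulf_neq0 ?invr_neq0.
  exists X; split=> //.
  suff -> : [ffun a : arc A => K a * (X (src a) / X (tgt a))] = eta by [].
  apply/ffunP => a; rewrite ffunE -XE; last by rewrite /underlying arc_in.
  by rewrite /psi arc_in gE mulrC divfK.
exists [ffun a => K a * (X (src a) / X (tgt a))].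
split; first exact: graded_acyclic.
  by split=> // a; rewrite ffunE !mulf_neq0 ?invr_neq0.
move=> p gp; split; first exact: graded_balanced_cycle.
have /andP[/andP[_ Up] _] := gp.
have KX (a : arc A) : K a / [ffun a => K a * (X (src a) / X (tgt a))] a =
    (X (src a) / X (tgt a))^-1.
  by rewrite ffunE invfM mulrA divff // mul1r.
rewrite (eq_bigr _ (fun a _ => KX a)) [RHS](eq_bigr _ (fun a _ => KX a)).
have := prod_next X0 Up.
rewrite (big_cycle_arcs _ (fun i j => X i / X j) graded_anti gp) /= => prod1.
rewrite prodfV.
apply: (mulfI (x := \prod_(a in arcs_fwd A p) (X (src a) / X (tgt a)))).
  rewrite prodf_seq_neq0; apply/allP => a _.
  by apply/implyP => _; rewrite mulf_neq0 ?invr_neq0.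
rewrite divff; last first.
  rewrite prodf_seq_neq0; apply/allP => a _.
  by apply/implyP => _; rewrite mulf_neq0 ?invr_neq0.
rewrite -[LHS]prod1; congr (_ * _).
by apply: eq_bigr => a _; rewrite invf_div.
Qed.

End Graded.

(** * Proper faces of the configuration *)

Section Faces.
Context (R : realType) (n : nat).

(** The linear functional with coefficients [alpha]. *)
Definition dot (alpha x : 'rV[R]_n) : R := \sum_i alpha 0 i * x 0 i.

Lemma dotB alpha x y : dot alpha (x - y) = dot alpha x - dot alpha y.
Proof. by rewrite /dot -sumrB; apply: eq_bigr => i _; rewrite !mxE mulrBr. Qed.

Lemma dot0 alpha : dot alpha 0 = 0.
Proof. by rewrite -(subr0 0) dotB subrr. Qed.

Lemma dotN alpha x : dot alpha (- x) = - dot alpha x.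
Proof. by rewrite -sub0r dotB dot0 sub0r. Qed.

(** Any function on the nodes extends, up to an additive constant, to a linear
    functional. *)
Lemma dot_evec (g : 'I_n.+1 -> R) i :
  dot (\row_l (g (lift ord0 l) - g ord0)) (evec R i) = g i - g ord0.
Proof.
rewrite /dot; case: (unliftP ord0 i) => [l|] ->; last first.
  by rewrite subrr big1 // => l _; rewrite !mxE (negPf (neq_lift ord0 l)) mulr0.
rewrite (bigD1 l) //= !mxE eqxx mulr1 big1 ?addr0 // => m ml.
by rewrite !mxE (inj_eq (@lift_inj _ (ord0 : 'I_n.+1))) eq_sym (negPf ml) mulr0.
Qed.

(** A point of the configuration other than the origin determines its arc. *)
Lemma evec_diff_inj (i j i' j' : 'I_n.+1) : i != j ->
  evec R i - evec R j = evec R i' - evec R j' -> i = i' /\ j = j'.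
Proof.
move=> nij eij.
have eqg (g : 'I_n.+1 -> R) : g i - g j = g i' - g j'.
  have := congr1 (dot (\row_l (g (lift ord0 l) - g ord0))) eij.
  rewrite !dotB !dot_evec => /eqP; rewrite !opprB !addrA !subrK => /eqP.
  by [].
(* Indicator functions of nodes now separate the endpoints. *)
have ii' : i = i'.
  have /eqP := eqg (fun v => (v == i)%:R).
  rewrite eqxx [j == i]eq_sym (negPf nij) subr0.
  have [->//|_] := eqVneq i' i; case: (j' == i) => /=.
    by rewrite sub0r -subr_eq0 opprK -mulr2n pnatr_eq0.
  by rewrite subr0 oner_eq0.
split=> //; have /eqP := eqg (fun v => (v == j)%:R).
rewrite -ii' eqxx (inj_eq (addrI _)) eqr_opp.
have [->//|_] := eqVneq j' j; by rewrite oner_eq0.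
Qed.

Lemma conv_hull_sub (S : set 'rV[R]_n) : S `<=` conv_hull S.
Proof.
move=> x Sx; exists 1%N, (fun=> 1), (fun=> x); split=> //.
  by rewrite big_ord1.
by rewrite big_ord1 scale1r.
Qed.

Lemma nablaN (G : rel 'I_n.+1) v : nabla R G v -> nabla R G (- v).
Proof.
case=> [->|[i [j [Gij vE]]]]; first by left; rewrite oppr0.
right; exists i, j; split=> //; case: vE => ->; first by right.
by left; rewrite opprK.
Qed.

(** The height of a node [i] is the value at [evec i] of a functional supporting
    the face. *)
Lemma face_grading (G : rel 'I_n.+1) (F : set 'rV[R]_n) :
  symmetric G -> proper_face_nabla G F ->
  ~ F 0 /\ exists (h : 'I_n.+1 -> R) (c : R), 0 < c /\
    forall i j, (i, j) \in facial_arcs F -> G i j /\ h i - h j = c.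
Proof.
move=> G_sym [F_sub [[alpha [c [le_c FE]]] F_neq] F_cap].
have FP v : F v <-> nabla R G v /\ dot alpha v = c.
  split=> [Fv|[nv dv]].
    split; first exact: F_sub.
    by have := conv_hull_sub Fv; rewrite FE => -[].
  by rewrite F_cap; split=> //; rewrite FE; split=> //; apply: conv_hull_sub.
have dot_le v : nabla R G v -> dot alpha v <= c.
  by move=> nv; apply/le_c/conv_hull_sub.
have n0 : nabla R G 0 by left.
have F0 : ~ F 0.
  move=> /FP[_]; rewrite dot0 => c0; apply: F_neq; congr conv_hull.
  apply/seteqP; split=> // v nv; apply/FP; split=> //; apply/eqP.
  rewrite eq_le dot_le //= -lerN2 -dotN -c0 oppr0 c0.
  exact/dot_le/nablaN.
have c_gt0 : 0 < c.
  rewrite lt_neqAle -{2}(dot0 alpha) dot_le // andbT.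
  by apply/eqP => c0; apply: F0; apply/FP; rewrite dot0.
split=> //; exists (fun i => dot alpha (evec R i)), c; split=> // i j.
rewrite inE /= => /set_mem /[dup] Fij /FP[nij]; rewrite dotB => dij.
split=> //; have nij0 : i != j.
  by apply/eqP => ij; apply: F0; move: Fij; rewrite ij subrr.
case: nij => [e0|[i' [j' [Gij]]]]; first by rewrite e0 in Fij.
rewrite opprB => -[] /(evec_diff_inj nij0)[-> ->] //.
by rewrite G_sym.
Qed.

End Faces.

(** * The initial system *)

Section InitialSystem.
Context (R : realType) (n : nat) (F : set 'rV[R]_n).
Local Notation C := R[i].

(** The value at [x] of the Laurent monomial with exponent [m]. *)
Definition lmonom (x : 'I_n -> C) (m : 'rV[int]_n) : C := \prod_l x l ^ m 0 l.

(** The value at [x] of the initial form of that monomial. *)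
Definition init_monom (x : 'I_n -> C) (m : 'rV[int]_n) : C :=
  if map_mx intr m \in F then lmonom x m else 0.

(** Evaluation of initial forms is the additive extension of its values on
    monomials. *)
Lemma leval_linit (f : laurent C n) (x : 'I_n -> C) :
  leval (linit F f) x = mmap idfun (init_monom x) f.
Proof.
rewrite -[LHS]/(mmap idfun (lmonom x) (linit F f)) /linit raddf_sum /=.
rewrite mmapE big_mkcond; apply: eq_bigr => m _; rewrite /init_monom.
by case: ifP => _; rewrite ?mulr0 // mmapU.
Qed.

(** The value of the variable at each node, with [x_0 = 1]. *)
Definition node_value (x : 'I_n -> C) (i : 'I_n.+1) : C :=
  if unlift ord0 i is Some l then x l else 1.

Lemma node_value_neq0 x i : (forall l, x l != 0) -> node_value x i != 0.
Proof.
by move=> x0; rewrite /node_value; case: unlift => *; rewrite ?oner_eq0.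
Qed.

Lemma lmonom_arc x (i j : 'I_n.+1) : (forall l, x l != 0) ->
  lmonom x (evec int i - evec int j) = node_value x i / node_value x j.
Proof.
move=> x0; rewrite /lmonom.
have prod_evec k : \prod_l x l ^ evec int k 0 l = node_value x k.
  rewrite /node_value; case: unliftP => [l|] ->; last first.
    by rewrite big1 // => l _; rewrite mxE (negPf (neq_lift ord0 l)) expr0z.
  rewrite (bigD1 l) //= mxE eqxx expr1z big1 ?mulr1 // => m ml.
  rewrite mxE (inj_eq (@lift_inj _ (ord0 : 'I_n.+1))) eq_sym (negPf ml).
  by rewrite expr0z.
rewrite -!prod_evec -prodf_div; apply: eq_bigr => l _.
by rewrite !mxE expfzDr // -invr_expz.
Qed.

Lemma map_evec (i j : 'I_n.+1) :
  map_mx intr (evec int i - evec int j) = evec R i - evec R j.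
Proof. by apply/rowP => l; rewrite !mxE rmorphB /= !mulrz_nat. Qed.

Lemma init_monom_arc x (i j : 'I_n.+1) : (forall l, x l != 0) ->
  init_monom x (evec int i - evec int j) =
  if (i, j) \in facial_arcs F then node_value x i / node_value x j else 0.
Proof. by move=> x0; rewrite /init_monom map_evec lmonom_arc // inE. Qed.

(** The initial form at node [v] is, up to a constant factor, the inflow minus the
    outflow at [v]. *)
Lemma init_kuramoto (G : rel 'I_n.+1) (w : 'I_n -> C)
    (k : 'I_n.+1 -> 'I_n.+1 -> C) (x : 'I_n -> C) (l : 'I_n)
    (X := node_value x) (v := lift ord0 l) :
  symmetric G -> edge_weights G k -> ~ F 0 ->
  (forall i j, (i, j) \in facial_arcs F -> G i j) ->
  (forall l, x l != 0) ->
  leval (linit F (kuramoto G w k l)) x =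
  (2 * 'i)^-1 * (\sum_(j | (j, v) \in facial_arcs F) k j v * (X j / X v) -
                 \sum_(j | (v, j) \in facial_arcs F) k v j * (X v / X j)).
Proof.
move=> G_sym kG F0 FG x0; rewrite leval_linit /kuramoto -/v.
rewrite mmapB mmapU {1}/init_monom map_mx0 ifN ?mulr0 ?sub0r; last first.
  by apply/negP => /set_mem.
rewrite (raddf_sum (mmap idfun (init_monom x))) /=.
rewrite -[RHS]opprK -mulrN opprB; congr (- _).
rewrite mulrBr !mulr_sumr.
rewrite (eq_bigr (fun j =>
    k v j / (2 * 'i) * init_monom x (evec int v - evec int j) -
    k v j / (2 * 'i) * init_monom x (evec int j - evec int v))); last first.
  by move=> j _; rewrite raddfB /= !mmapU.
rewrite sumrB; congr (_ - _).
  rewrite [LHS]big_mkcond [RHS]big_mkcond; apply: eq_bigr => j _.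
  rewrite init_monom_arc //; case: ifP => Gjv; case: ifP => vj //.
  - by rewrite mulrAC [RHS]mulrC.
  - by rewrite mulr0.
  - by move/FG: vj; rewrite G_sym Gjv.
rewrite [LHS]big_mkcond [RHS]big_mkcond; apply: eq_bigr => j _.
rewrite init_monom_arc //; case: ifP => Gjv; case: ifP => vj //.
- by rewrite mulrAC [RHS]mulrC (kG _ _ Gjv).2.
- by rewrite mulr0.
- by move/FG: vj; rewrite Gjv.
Qed.

Lemma leval_randomized (Q : 'M[C]_n) (f : 'I_n -> laurent C n) x m :
  leval (linit F (randomized Q f m)) x =
  \sum_l Q m l * leval (linit F (f l)) x.
Proof.
rewrite leval_linit /randomized raddf_sum; apply: eq_bigr => l _ /=.
rewrite leval_linit (mmapEw (msuppZ_le _ _)) mmapE big_distrr /=.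
by apply: eq_bigr => e _; rewrite mcoeffZ mulrA.
Qed.

Lemma randomized_zeros (Q : 'M[C]_n) (f : 'I_n -> laurent C n) x :
  Q \in unitmx ->
  (forall m, leval (linit F (randomized Q f m)) x = 0) <->
  (forall l, leval (linit F (f l)) x = 0).
Proof.
move=> Qu; split=> f0; last first.
  by move=> m; rewrite leval_randomized big1 // => l _; rewrite f0 mulr0.
pose y : 'cV[C]_n := \col_l leval (linit F (f l)) x.
have Qy : Q *m y = 0.
  apply/colP => m; rewrite !mxE -[RHS](f0 m) leval_randomized.
  by apply: eq_bigr => l _; rewrite mxE.
move=> l; have := congr1 (fun z : 'cV_n => (invmx Q *m z) l 0) Qy.
by rewrite mulKmx // mulmx0 !mxE.
Qed.

End InitialSystem.

(** * Exceptional coefficients *)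

(** The equations of the initial system are conservation at the nodes other
    than 0, for the flow [K_ij X_i / X_j]. *)
Lemma exceptional_iff (R : realType) (n : nat) (G : rel 'I_n.+1)
    (w : 'I_n -> R[i]) (Q : 'M[R[i]]_n) (F : set 'rV[R]_n)
    (K : arc_coefs F) :
  symmetric G -> Q \in unitmx -> proper_face_nabla G F ->
  exceptional G w Q F K <-> in_torus K /\
  exists X : 'I_n.+1 -> R[i], (forall v, X v != 0) /\
   circulation [ffun a : arc (facial_arcs F) => K a * (X (src a) / X (tgt a))].
Proof.
move=> G_sym Qu /(face_grading G_sym)[F0 [h [c [c0 hA]]]].
have FG i j : (i, j) \in facial_arcs F -> G i j by case/hA.
have anti := graded_anti c0 (fun i j Aij => (hA i j Aij).2).
have i2 : (2 * 'i)^-1 != 0 :> R[i].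
  by rewrite invr_neq0 // mulf_neq0 ?pnatr_eq0 ?neq0Ci.
pose flow k X (a : arc (facial_arcs F)) : R[i] :=
  k (src a) (tgt a) * (X (src a) / X (tgt a)).
have inE k X v : \sum_(a : arc (facial_arcs F) | tgt a == v) flow k X a =
    \sum_(j | (j, v) \in facial_arcs F) k j v * (X j / X v).
  exact: (@big_arcs_tgt _ _ _ _ _ (fun i j => k i j * (X i / X j))).
have outE k X v : \sum_(a : arc (facial_arcs F) | src a == v) flow k X a =
    \sum_(j | (v, j) \in facial_arcs F) k v j * (X v / X j).
  exact: (@big_arcs_src _ _ _ _ _ (fun i j => k i j * (X i / X j))).
split=> [[K0 [k [kG kK [x [x0 /(randomized_zeros _ _ _ Qu) fx]]]]]|].
  split=> //; exists (node_value x); split=> [v|]; first exact: node_value_neq0.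
  apply: (@circulation_but_one _ _ _ _ ord0) => v v0.
  have flowE (a : arc (facial_arcs F)) :
      [ffun a => K a * (node_value x (src a) / node_value x (tgt a))] a =
      flow k (node_value x) a by rewrite ffunE /flow kK.
  rewrite (eq_bigr _ (fun a _ => flowE a)).
  rewrite [RHS](eq_bigr _ (fun a _ => flowE a)).
  rewrite inE outE; have [l vl|v0'] := unliftP ord0 v;
    last by rewrite v0' eqxx in v0.
  have /eqP := fx l; rewrite init_kuramoto // -vl mulf_eq0 (negPf i2) subr_eq0.
  by move/eqP.
case=> K0 [X [X0 circ]]; split=> //.
(* Extend [K] symmetrically, by 1 on the edges outside the facial graph. *)
pose k i j : R[i] := if insub (i, j) is Some a then K a else
  if insub (j, i) is Some a then K a else 1.
have kK (a : arc (facial_arcs F)) : k (src a) (tgt a) = K a.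
  by rewrite /k -surjective_pairing valK.
have kG : edge_weights G k.
  move=> i j _; rewrite /k.
  case: (insubP _ (i, j)) => [a Aij _|Nij].
    by rewrite insubN ?anti //; split=> //; apply: K0.
  by case: insubP => [a _ _|_]; split=> //; rewrite ?oner_neq0 ?K0.
exists k; split=> //.
(* Normalize the value at node 0 to be 1. *)
pose x l := X (lift ord0 l) / X ord0.
have x0 l : x l != 0 by rewrite mulf_neq0 ?invr_neq0.
have xX v : node_value x v = X v / X ord0.
  by rewrite /node_value; case: unliftP => [l|] ->; rewrite ?divff.
exists x; split=> //; apply/(randomized_zeros _ _ _ Qu) => l.
rewrite init_kuramoto // -inE -outE.
have flowE (a : arc (facial_arcs F)) : flow k (node_value x) a =
   [ffun a => K a * (X (src a) / X (tgt a))] a.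
  by rewrite ffunE /flow kK !xX -mulf_div divff ?mulr1 ?invr_neq0.
rewrite (eq_bigr _ (fun a _ => flowE a)).
rewrite [X in _ - X](eq_bigr _ (fun a _ => flowE a)).
by have/circulationP-> := circ; rewrite subrr mulr0.
Qed.

Theorem theorem4p17 (R : realType) (n : nat) (G : rel 'I_n.+1)
    (w : 'I_n -> R[i]) (Q : 'M[R[i]]_n) (F : set 'rV[R]_n)
    (G_sym : symmetric G) (G_irr : irreflexive G)
    (G_conn : forall i j, connect G i j)
    (Q_gen : generic_matrix G w Q)
    (F_face : proper_face_nabla G F) (F_neq0 : F !=set0) :
  (has_bridge (facial_graph F) -> exceptional G w Q F = set0) /\
  (bridgeless (facial_graph F) ->
     exceptional G w Q F =
     [set K | in_torus K /\
        exists eta : {ffun arc (facial_arcs F) -> R[i]}, balanced K eta]).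
Proof.
have [F0 [h [c [c_gt0 hA]]]] := face_grading G_sym F_face.
have {}hA i j (Fij : (i, j) \in facial_arcs F) : h i - h j = c.
  exact: (hA _ _ Fij).2.
have [Q_unit _] := Q_gen.
have excP K := exceptional_iff w K G_sym Q_unit F_face.
split=> [br|_]; apply/seteqP; split=> K //.
- case/excP=> K0 [X [X0 circ]].
  apply: (bridge_no_flow (graded_anti c_gt0 hA) br); split; first exact: circ.
  by move=> a; rewrite ffunE !mulf_neq0 ?invr_neq0.
- by case/excP=> K0 exX; split=> //; apply/(balanced_iff c_gt0 hA K0).
- case=> K0 bal; apply/excP; split=> //.
  exact/(balanced_iff c_gt0 hA K0).
Qed.
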